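(* Let $a\leqslant b$ be two positive integers, and let $G$ be a graph of order $n$, where $n\geqslant a+1$, and where $na\equiv 0\pmod{2}$ in the case $a=b$. If $G$ contains no $[a,b]$-factor, then $$\rho(G)\leqslant \rho(K_{a-1}\vee (K_{n-a}\cup K_1)),$$ with equality if and only if $G\cong K_{a-1}\vee (K_{n-a}\cup K_1)$.
   Context: For positive integers $a\leqslant b$, an $[a,b]$-factor of a graph $G$ is a spanning subgraph $F$ of $G$ such that $a\leqslant d_F(v)\leqslant b$ for all $v\in V(G)$. $\rho(G)$ denotes the spectral radius (largest eigenvalue) of the adjacency matrix of $G$. $G\cup H$ is the disjoint union and $G\vee H$ the join (disjoint union plus all edges between $G$ and $H$); $K_0\vee H=H$. *)

(* Defs.v *)
From mathcomp Require Import all_boot all_order all_algebra.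
From mathcomp Require Import classical_sets reals spectral complex polyrcf.

Set Implicit Arguments.
Unset Strict Implicit.
Unset Printing Implicit Defensive.

Import Order.TTheory GRing.Theory Num.Theory.
Local Open Scope ring_scope.

Record sgraph := SGraph {
  vertex :> finType;
  edge : rel vertex;
  edge_sym : symmetric edge;
  edge_irr : irreflexive edge
}.

Definition sg_iso (G H : sgraph) : Prop :=
  exists2 f : G -> H, bijective f & forall x y, edge (f x) (f y) = edge x y.

Lemma complete_sym n : symmetric (fun i j : 'I_n => i != j).
Proof. by move=> i j; rewrite eq_sym. Qed.

Lemma complete_irr n : irreflexive (fun i j : 'I_n => i != j).
Proof. by move=> i; rewrite eqxx. Qed.

Definition complete_graph n := SGraph (@complete_sym n) (@complete_irr n).

(* The value of [c] decides whether vertices of different sides are adjacent: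
   [false] gives the disjoint union, [true] the join. *)
Definition sum_edge (c : bool) (G H : sgraph) (x y : G + H) : bool :=
  match x, y with
  | inl u, inl v => edge u v
  | inr u, inr v => edge u v
  | _, _ => c
  end.

Lemma sum_edge_sym c G H : symmetric (@sum_edge c G H).
Proof. by move=> [u|u] [v|v] //=; apply: edge_sym. Qed.

Lemma sum_edge_irr c G H : irreflexive (@sum_edge c G H).
Proof. by move=> [u|u] /=; apply: edge_irr. Qed.

Definition graph_union G H :=
  SGraph (@sum_edge_sym false G H) (@sum_edge_irr false G H).

Definition graph_join G H :=
  SGraph (@sum_edge_sym true G H) (@sum_edge_irr true G H).

Definition spanning_subgraph (G : sgraph) (F : rel G) : Prop :=
  [/\ symmetric F, irreflexive F & forall x y, F x y -> edge x y].

Definition degree (T : finType) (F : rel T) (v : T) : nat := #|[set w | F v w]|.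

Definition has_factor (a b : nat) (G : sgraph) : Prop :=
  exists2 F : rel G,
    spanning_subgraph F & forall v : G, (a <= degree F v <= b)%N.

Definition adjacency (R : realType) (G : sgraph) : 'M[R]_#|G| :=
  \matrix_(i, j) (edge (enum_val i) (enum_val j))%:R.

(* When [G] has a vertex the supremum is attained: see [spectral_radius_max]. *)
Definition spectral_radius (R : realType) (G : sgraph) : R :=
  sup [set x : R | eigenvalue (adjacency R G) x]%classic.

Lemma sym_eigenvalue (R : realType) n (A : 'M[R]_n) : (0 < n)%N -> A^T = A ->
  exists x, eigenvalue A x.
Proof.
case: n A => // n A _ As; pose B : 'M[R[i]]_n.+1 := map_mx (real_complex R) A.
have BR : B \is a mxOver Num.real.
  by apply/mxOverP => i j; rewrite mxE; apply/complex_realP; exists (A i j).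
have BS : B \is symmetricmx.
  apply/is_hermitianmxP; rewrite expr0 scale1r; apply/matrixP => i j.
  by rewrite !mxE -[in LHS]As mxE.
have BH := realsym_hermsym BS BR.
have /mxOverP/(_ 0 0)/complex_realP[x xE] := hermitian_spectral_diag_real BH.
exists x; rewrite -(eigenvalue_map (real_complex R)) -/B.
have U := spectral_unit B.
apply/eigenvalueP; exists (row 0 (spectralmx B)); last first.
  apply/eqP => r0; move: U; rewrite -row_free_unit => /row_free_inj.
  have e : delta_mx 0 0 *m spectralmx B = 0 *m spectralmx B :> 'rV_n.+1.
    by rewrite -rowE r0 mul0mx.
  move=> /(_ _ _ _ e)/matrixP/(_ 0 0); rewrite !mxE !eqxx => /eqP.
  by rewrite oner_eq0.
have /hermitian_normalmx/orthomx_spectralP E := BH.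
by rewrite [X in _ *m X = _]E rowE !mulmxA mulmxK// -(rowE _ (diag_mx _)) row_diag_mx -scalemxAl xE.
Qed.

Lemma spectral_radius_max (R : realType) (G : sgraph) : (0 < #|G|)%N ->
  eigenvalue (adjacency R G) (spectral_radius R G) /\
  forall x, eigenvalue (adjacency R G) x -> x <= spectral_radius R G.
Proof.
move=> G0; set A := adjacency R G.
have [|x0 x0A] := @sym_eigenvalue R _ A G0.
  by apply/matrixP => i j; rewrite !mxE edge_sym.
have cp0 : char_poly A != 0 by rewrite monic_neq0// char_poly_monic.
pose s := rootsR (char_poly A).
have sP x : eigenvalue A x = (x \in s).
  by rewrite eigenvalue_root_char -roots_on_rootsR.
have [m ms mmax] : exists2 m, m \in s & forall x, x \in s -> x <= m.
  move: x0A; rewrite sP; elim: (s) x0 => // y t IH x0 _.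
  case: t IH => [|z t] IH.
    by exists y; [rewrite mem_head|move=> x /[!inE]/eqP->].
  have [m mt mmax] := IH z (mem_head _ _).
  exists (Num.max y m).
    by case: (leP y m) => _; rewrite inE ?mt ?orbT ?eqxx.
  by move=> x; rewrite inE le_max => /orP[/eqP->|/mmax->]; rewrite ?lexx ?orbT.
suff -> : spectral_radius R G = m.
  by rewrite sP; split=> // x; rewrite sP; apply: mmax.
apply/le_anti/andP; split.
  apply: ge_sup; first by exists m; rewrite /= sP.
  by move=> x /=; rewrite sP; apply: mmax.
apply: ub_le_sup; last by rewrite /= sP.
by exists m => x /=; rewrite sP; apply: mmax.
Qed.

(* Main.v *)
(** Let [D] be the complement of [G] and [k = n - 1 - a]. If some vertex of [G]
    has degree less than [a], then [G] is a spanning subgraph of a copy of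
    [K_{a-1} v (K_{n-a} u K_1)], and comparing Rayleigh quotients at a
    nonnegative eigenvector of [G] gives the inequality together with its
    equality case.

    Otherwise [G] has minimum degree at least [a], and testing
    [A^2 - (a - 1) A] against a nonnegative eigenvector gives
    [rho (rho - (a - 1)) <= 2 e(G) - a (n - 1)]. If [rho] were at least the
    claimed bound, which is at least [n - 2] and exceeds it when [a > 1], then
    [D] would have degree sum at most [n + k - 2] (one more if [a = 1]) and
    maximum degree at most [k], and such a [D] leaves room for a factor. Indeed,
    if [n a] is even, take an edge-minimal [D] without a disjoint [a]-regular
    graph. Deleting an edge [xy] of [D] yields a graph [F] disjoint from [D]
    with all degrees [a] except [a - 1] at [x] and [y]. Let [W] be the complement
    of [D] and [F], let [A], [B] be the [W]-neighbourhoods of [x], [y] and [P],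
    [Q] the [F]-neighbourhoods of [A], [B]. As there is no alternating trail of
    length 3 or 5 from [x] to [y], no [F]-edge joins [A] to [B] and no [W]-edge
    joins [P] to [Q], so all pairs between [P] and [Q] lie in [F] or [D]; counting
    them row by row forces more edges in [D] than it has. If [n a] is odd, add a
    vertex adjacent to everything, find an [(a + 1)]-factor and delete that vertex. *)

Require Import Defs.
From mathcomp Require Import all_boot all_order all_algebra.
From mathcomp Require Import reals spectral complex zify ring lra.
From mathcomp Require boolp classical_sets.

Set Implicit Arguments.
Unset Strict Implicit.
Unset Printing Implicit Defensive.

(** * Regular factors disjoint from a sparse graph *)

Lemma degreeE (T : finType) (F : rel T) v : degree F v = \sum_w (F v w : nat).
Proof.
rewrite /degree cardsE -sum1_card big_mkcond; apply: eq_bigr => w _.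
by rewrite unfold_in; case: (F v w).
Qed.

Lemma cardE_sum (T : finType) (A : {set T}) : #|A| = \sum_v (v \in A : nat).
Proof. by rewrite -sum1_card big_mkcond; apply: eq_bigr => w _; case: (w \in A). Qed.

Lemma sum_delta (T : finType) (x : T) : \sum_v (v == x : nat) = 1.
Proof. by rewrite (bigD1 x) //= eqxx big1 // => v /negbTE ->. Qed.

Lemma sum_one (T : finType) : \sum_(v : T) 1 = #|T|.
Proof. exact: sum1_card. Qed.

(** * Adding and deleting an edge; factors deficient at two vertices *)

Section Toggle.
Variables (T : finType).
Implicit Types (F D : rel T) (p q x y u v w : T).

Definition toggle F p q : rel T := fun v w =>
  F v w (+) ((v == p) && (w == q) || (v == q) && (w == p)).

Lemma toggle_sym F p q : symmetric F -> symmetric (toggle F p q).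
Proof. by move=> Fs v w; rewrite /toggle Fs orbC; congr (_ (+) (_ || _)); rewrite andbC. Qed.

Lemma toggle_irr F p q : p != q -> irreflexive F -> irreflexive (toggle F p q).
Proof.
move=> pq Fi v; rewrite /toggle Fi /=.
by case: (v =P p) => [->|_]; rewrite ?(negbTE pq) ?andbF.
Qed.

Lemma toggle_other F p q v w :
  ~ (v = p /\ w = q) -> ~ (v = q /\ w = p) -> toggle F p q v w = F v w.
Proof.
move=> h1 h2; rewrite /toggle; case h: (_ || _); last by rewrite addbF.
by case/orP: h => /andP[/eqP e1 /eqP e2]; [case: h1|case: h2].
Qed.

Lemma degree_toggle_add F p q v : p != q -> symmetric F -> ~~ F p q ->
  degree (toggle F p q) v = degree F v + (v == p) + (v == q).
Proof.
move=> pq Fs Fpq; rewrite !degreeE.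
have -> : (v == p : nat) = \sum_w ((v == p) && (w == q) : nat).
  by case: eqP => _ /=; rewrite ?sum_delta ?big1.
have -> : (v == q : nat) = \sum_w ((v == q) && (w == p) : nat).
  by case: eqP => _ /=; rewrite ?sum_delta ?big1.
rewrite -!big_split; apply: eq_bigr => w _ /=; rewrite /toggle.
have Fqp := Fs q p; rewrite (negbTE Fpq) in Fqp.
case: (boolP ((v == p) && (w == q))) => [/andP[/eqP-> /eqP->]|_].
  by rewrite (negbTE pq) (negbTE Fpq).
case: (boolP ((v == q) && (w == p))) => [/andP[/eqP-> /eqP->]|_].
  by rewrite Fqp.
by rewrite addbF !addn0.
Qed.

Lemma toggleK F p q : toggle (toggle F p q) p q =2 F.
Proof. by move=> v w; rewrite /toggle addbK. Qed.

Lemma degree_toggle_del F p q v : p != q -> symmetric F -> F p q ->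
  degree (toggle F p q) v + (v == p) + (v == q) = degree F v.
Proof.
move=> pq Fs Fpq; rewrite -degree_toggle_add //; last 2 first.
- exact: toggle_sym.
- by rewrite /toggle Fpq !eqxx.
by rewrite !degreeE; apply: eq_bigr => w _; rewrite toggleK.
Qed.

Definition regular_factor D a F :=
  [/\ symmetric F, irreflexive F, forall v w, F v w -> ~~ D v w
    & forall v, degree F v = a].

(** The deficiency is written additively so that [x = y] is allowed and then means degree [a - 2];
    [near_factor_shift] produces this state when [p = y]. *)
Definition near_factor D a x y F :=
  [/\ symmetric F, irreflexive F, forall v w, F v w -> ~~ D v w
    & forall v, degree F v + (v == x) + (v == y) = a].

Lemma near_factorC D a x y F : near_factor D a x y F -> near_factor D a y x F.
Proof. by case=> ? ? ? h; split=> // v; rewrite addnAC. Qed.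

Lemma toggle_disjoint F D p q : symmetric D ->
  (forall v w, F v w -> ~~ D v w) -> ~~ D p q ->
  forall v w, toggle F p q v w -> ~~ D v w.
Proof.
move=> Ds FD Dpq v w; case h: ((v == p) && (w == q) || (v == q) && (w == p)).
  by case/orP: h => /andP[/eqP-> /eqP->] _; rewrite // Ds.
by rewrite /toggle h addbF; apply: FD.
Qed.

(** Adding [xu] and deleting [up] repairs [x], leaves the degree of [u] unchanged and lowers that of
    [p]: one deficiency travels two steps along an alternating trail. *)
Lemma near_factor_shift D a x y u p F : symmetric D ->
  near_factor D a x y F -> x != u -> F x u = false -> D x u = false -> F u p ->
  near_factor D a p y (toggle (toggle F x u) u p).
Proof.
move=> Ds [Fs Fi FD Fd] xu Fxu Dxu Fup.
have up : u != p by apply/eqP => e; rewrite e Fi in Fup.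
have px : p <> x by move=> e; rewrite e Fs Fxu in Fup.
have F1 : toggle F x u u p.
  by rewrite toggle_other //; [case=> e; rewrite e eqxx in xu|case].
have s1 : symmetric (toggle F x u) by exact: toggle_sym.
split.
- exact: toggle_sym.
- by apply: toggle_irr => //; apply: toggle_irr.
- apply: toggle_disjoint => //; last exact: FD.
  by apply: toggle_disjoint => //; rewrite Dxu.
move=> v; have := degree_toggle_del v up s1 F1.
have := degree_toggle_add v xu Fs; rewrite Fxu => /(_ isT).
have := Fd v; lia.
Qed.

Lemma near_factor_close D a x y F : symmetric D ->
  near_factor D a x y F -> x != y -> F x y = false -> D x y = false ->
  regular_factor D a (toggle F x y).
Proof.
move=> Ds [Fs Fi FD Fd] xy Fxy Dxy; split.
- exact: toggle_sym.
- exact: toggle_irr.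
- by apply: toggle_disjoint => //; rewrite Dxy.
by move=> v; rewrite degree_toggle_add // Fxy.
Qed.

End Toggle.

(** * Alternating trails of length 3 and 5 *)

Section Augment.
Variables (T : finType) (D F : rel T) (a : nat) (x y : T).
Hypotheses (Ds : symmetric D) (Di : irreflexive D) (Dxy : D x y).
Hypothesis nF : near_factor D a x y F.
Hypothesis no_factor : forall F', ~ regular_factor D a F'.

(** The graph [W] of the overview: the edges that may be added to [F]. *)
Definition spare_edge : rel T := fun v w => [&& v != w, ~~ F v w & ~~ D v w].

Lemma spare_sym : symmetric spare_edge.
Proof. by case: nF => Fs _ _ _ v w; rewrite /spare_edge eq_sym Fs Ds. Qed.

Let spareE v w : spare_edge v w ->
  [/\ v <> w, F v w = false, F w v = false, D v w = false & D w v = false].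
Proof.
by case: nF => Fs _ _ _; case/and3P => /eqP vw /negbTE e1 /negbTE e2; rewrite (Fs w) (Ds w).
Qed.

(** Otherwise the deficiency of [x] could be shifted to [p] and the edge [py] added. [D x y] and
    irreflexivity exclude the coincidences that would disturb this last edge. *)
Lemma no_augment3 u p : spare_edge x u -> F u p -> ~~ spare_edge y p.
Proof.
move=> /spareE[xu Fxu Fux Dxu Dux] Fup; apply/negP => /spareE[yp Fyp Fpy Dyp Dpy].
have [Fs Fi FD _] := nF; have Fpu : F p u by rewrite Fs.
have Dyx : D y x by rewrite Ds.
have n1 := near_factor_shift Ds nF (introN eqP xu) Fxu Dxu Fup.
apply: (no_factor (near_factor_close Ds n1 _ _ Dpy)).
  by apply/eqP => e; case: yp.
rewrite !toggle_other // => -[e1 e2]; subst; congruence.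
Qed.

(* The case [p = y], in which the trail passes through [y], is included. *)
Lemma no_augment5 u p w q : spare_edge x u -> F u p -> spare_edge y w -> F w q -> ~~ spare_edge p q.
Proof.
move=> sxu Fup syw Fwq; apply/negP => spq.
have no1 := no_augment3 sxu Fup.
move: (sxu) (syw) (spq) => /spareE[xu Fxu Fux Dxu Dux] /spareE[yw Fyw Fwy Dyw Dwy].
move=> /spareE[pq Fpq Fqp Dpq Dqp].
have [Fs Fi FD _] := nF; have Fpu : F p u by rewrite Fs.
have Fqw : F q w by rewrite Fs.
have Dyx : D y x by rewrite Ds.
(* If [p] were [w], then [x u p y] would be a trail of length 3. This keeps the shifts at the two
   ends from interfering. *)
have pw : p <> w by move=> e; rewrite e syw in no1.
have n1 := near_factor_shift Ds nF (introN eqP xu) Fxu Dxu Fup.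
set F1 := toggle _ _ _ in n1.
have F1yw : F1 y w = false.
  by rewrite /F1 !toggle_other // => -[e1 e2]; subst; congruence.
have F1wq : F1 w q.
  by rewrite /F1 !toggle_other // => -[e1 e2]; subst; congruence.
have n2 := near_factor_shift Ds (near_factorC n1) (introN eqP yw) F1yw Dyw F1wq.
apply: (no_factor (near_factor_close Ds n2 _ _ Dqp)).
  by apply/eqP => e; case: pq.
rewrite /F1 !toggle_other // => -[e1 e2]; subst; congruence.
Qed.

End Augment.

(** * Cell by cell count of the adjacency matrix of [D] *)

Lemma cell_bound (d pP qQ yP xQ px py qx qy : bool) :
  (px -> ~~ pP) -> (qy -> ~~ qQ) -> (py -> pP = yP) -> (qx -> qQ = xQ) ->
  ~~ (px && py) -> ~~ (qx && qy) -> (px && qx -> ~~ d) -> (py && qy -> ~~ d) ->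
  [&& pP, qQ & d] + (px && d) + (qy && d) + ~~ yP * (py && d) + ~~ xQ * (qx && d)
  <= d + ((px && qy) + (~~ yP && ~~ xQ) * (py && qx)).
Proof.
case: d; last by rewrite !andbF !muln0.
case: px; case: py => //=; case: qx; case: qy => //=; case: pP => //=;
  by case: qQ => //=; case: yP => //=; case: xQ => //=; move=> *; intuition.
Qed.

Section EdgeCount.
Variables (T : finType) (D : rel T).
Hypotheses (Ds : symmetric D) (Di : irreflexive D).

Lemma sum_delta_and (x : T) (c : T -> bool) :
  \sum_v ((v == x) && c v : nat) = c x.
Proof.
rewrite (bigD1 x) //= eqxx big1 ?addn0 // => v /negbTE -> //.
Qed.

Lemma sum_row x : \sum_p \sum_q ((p == x) && D p q : nat) = degree D x.
Proof.
rewrite (bigD1 x) //= [X in _ + X]big1 => [|p /negbTE px].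
  by rewrite addn0 degreeE; apply: eq_bigr => q _; rewrite eqxx.
by apply: big1 => q _; rewrite px.
Qed.

Lemma sum_col y : \sum_p \sum_q ((q == y) && D p q : nat) = degree D y.
Proof. by rewrite degreeE; apply: eq_bigr => p _; rewrite sum_delta_and Ds. Qed.

Lemma sum_cell (x y : T) : \sum_p \sum_q ((p == x) && (q == y) : nat) = 1.
Proof.
rewrite exchange_big (bigD1 y) //= [X in _ + X]big1 => [|q /negbTE qy].
  by rewrite addn0 sum_delta_and eqxx.
by apply: big1 => p _; rewrite qy andbF.
Qed.

(** Row [x], column [y], row [y] if [y] is outside [P], and column [x] if [x] is outside [Q] all
    avoid the block of rows [P] and columns [Q]. Off the diagonal, where [D] vanishes, these lines
    meet only at [(x, y)] and [(y, x)]; the extra terms on the right pay for these two cells.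
    [cell_bound] is the check at one cell, with [px] for [p == x], [pP] for [p \in P], and so on. *)
Lemma edge_count (x y : T) (P Q : {set T}) : D x y -> x \notin P -> y \notin Q ->
  \sum_p \sum_q ([&& p \in P, q \in Q & D p q] : nat) + degree D x + degree D y
    + (y \notin P) * degree D y + (x \notin Q) * degree D x
  <= \sum_v degree D v + 1 + ((y \notin P) && (x \notin Q)).
Proof.
move=> Dxy xP yQ; have Dyx : D y x by rewrite Ds.
have xy : x != y by apply/eqP => e; rewrite e Di in Dxy.
rewrite -[_ + 1 + _]addnA.
have -> : 1 + ((y \notin P) && (x \notin Q)) =
    \sum_p \sum_q ((p == x) && (q == y) : nat)
    + ((y \notin P) && (x \notin Q)) * \sum_p \sum_q ((p == y) && (q == x) : nat).
  by rewrite !sum_cell muln1.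
rewrite -{1}(sum_row x) -(sum_col x) -{1}(sum_col y) -(sum_row y).
under [\sum_v degree D v]eq_bigr do rewrite degreeE.
rewrite !big_distrr -!big_split; apply: leq_sum => p _ /=.
rewrite !big_distrr -!big_split; apply: leq_sum => q _ /=.
apply: cell_bound.
- by case: eqP => [->|].
- by case: eqP => [->|].
- by case: eqP => [->|//].
- by case: eqP => [->|//].
- by case: eqP => [->|//]; rewrite (negbTE xy).
- by case: eqP => [->|//]; rewrite (negbTE xy).
- by case: eqP => [->|//] /= /eqP ->; rewrite Di.
by case: eqP => [->|//] /= /eqP ->; rewrite Di.
Qed.

End EdgeCount.

(** * Neighbourhood counts in the absence of short alternating trails *)

Section Stuck.
Variables (T : finType) (D F : rel T) (a k : nat).
Hypotheses (Ds : symmetric D) (Di : irreflexive D) (cT : #|T| = a + k + 1).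
Implicit Types (x y u v w p q : T).

Local Notation spare := (spare_edge D F).

(** What the counting uses of the absence of a regular factor, in a form symmetric in [x] and [y]:
    by [stuckC] every bound below also holds with the ends exchanged. *)
Definition stuck x y :=
  [/\ D x y, near_factor D a x y F,
      forall u p, spare x u -> F u p -> ~~ spare y p,
      forall u p, spare y u -> F u p -> ~~ spare x p
    & forall u p w q, spare x u -> F u p -> spare y w -> F w q -> ~~ spare p q].

Lemma no_factor_stuck x y : D x y -> near_factor D a x y F ->
  (forall F', ~ regular_factor D a F') -> stuck x y.
Proof.
move=> Dxy nF nof; have Dyx : D y x by rewrite Ds.
split=> //.
- by move=> u p; apply: (no_augment3 Ds Di Dxy nF nof).
- by move=> u p; apply: (no_augment3 Ds Di Dyx (near_factorC nF) nof).
by move=> u p w q; apply: (no_augment5 Ds Di Dxy nF nof).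
Qed.

Lemma stuckC x y : stuck x y -> stuck y x.
Proof.
case=> Dxy nF h3 h3' h5; split=> //; [by rewrite Ds|exact: near_factorC|].
by move=> u p w q xu Fup yw Fwq; rewrite (spare_sym Ds nF); apply: (h5 w q u p).
Qed.

(** At [x] the sets [spares] and [reach] are the [A] and [P] of the overview, at [y] they are [B]
    and [Q]. *)
Definition spares v := [set u | spare v u].
Definition reach v := [set p | [exists u, spare v u && F u p]].

Lemma degree_split x y v : near_factor D a x y F ->
  1 + degree F v + degree D v + #|spares v| = #|T|.
Proof.
case=> Fs Fi FD _; rewrite -(sum_delta v) -sum_one !degreeE cardE_sum -!big_split.
apply: eq_bigr => w _ /=; rewrite inE /spare_edge [v == w]eq_sym.
case: (w =P v) => [->|_] /=; first by rewrite Fi Di.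
by have := FD v w; case: (F v w) => [/(_ isT)/negbTE ->|_] //=; case: (D v w).
Qed.

Section Pair.
Variables (x y : T).
Hypothesis xyS : stuck x y.

Let nF : near_factor D a x y F. Proof. by case: xyS. Qed.
Let Fs : symmetric F. Proof. by case: nF. Qed.
Let Dxy : D x y. Proof. by case: xyS. Qed.
Let Dyx : D y x. Proof. by rewrite Ds. Qed.
Let xy : (x == y) = false.
Proof. by apply/negP => /eqP e; move: Dxy; rewrite e Di. Qed.

Lemma card_spares : #|spares x| + degree D x = k + 1.
Proof.
have := degree_split x nF; case: nF => _ _ _ /(_ x); rewrite eqxx xy.
lia.
Qed.

Lemma degree_spare u : spare x u -> degree F u = a.
Proof.
case: nF => _ _ _ /(_ u) <- /and3P[xu _ Dxu].
rewrite [u == x]eq_sym (negbTE xu) !addn0; case: eqP => [e|_]; last by rewrite addn0.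
by rewrite e Dxy in Dxu.
Qed.

Lemma spare_reach u : spare x u -> forall p, F u p -> p \in reach x.
Proof. by move=> xu p Fup; rewrite inE; apply/existsP; exists u; rewrite xu. Qed.

Lemma card_reach u : spare x u -> a <= #|reach x|.
Proof.
move=> xu; rewrite -(degree_spare xu) subset_leq_card //.
by apply/subsetP => p; rewrite inE; apply: spare_reach.
Qed.

Lemma reachP p : reflect (exists2 u, spare x u & F u p) (p \in reach x).
Proof.
rewrite inE; apply: (iffP existsP) => [[u /andP[? ?]]|[u ? ?]]; exists u => //.
exact/andP.
Qed.

Lemma notin_reach : x \notin reach x.
Proof. by apply/negP => /reachP[u /and3P[_ /negP xu _]]; rewrite Fs. Qed.

Lemma spare_notin_reach w : spare y w -> w \notin reach x.
Proof.
case: xyS => _ _ h3 _ _ yw; apply/negP => /reachP[u xu Fuw].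
by move: (h3 _ _ xu Fuw); rewrite yw.
Qed.

(** For [u] in [spares x], the [a] neighbours of [u] in [F], the set [spares y] and two further
    vertices [x] and [e] are disjoint. Hence [spares y] has at most [k - 1] elements, and [D] covers
    the rest at [y]. *)
Lemma degree_end_ge2 : degree D x <= k -> 1 < degree D y.
Proof.
move=> dx; have /card_gt0P[u] : 0 < #|spares x| by have := card_spares; lia.
rewrite inE => xu.
have [_ _ h3 h3' _] := xyS.
have cB : #|spares y| + degree D y = k + 1.
  have := degree_split y nF; case: nF => _ _ _ /(_ y); rewrite eqxx [y == x]eq_sym xy.
  lia.
(* The vertex [u] is outside both sets unless it lies in [spares y]; in that case [y] is not an
   [F]-neighbour of [u] and serves instead. *)
pose e := if spare y u then y else u.
suff : degree F u + #|spares y| + 1 + 1 <= #|T|.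
  by rewrite (degree_spare xu); lia.
rewrite -{1}(sum_delta x) -(sum_delta e) -sum_one degreeE cardE_sum -!big_split.
apply: leq_sum => v _ /=; rewrite inE.
have fx : v = x -> F u v = false /\ spare y v = false.
  by move=> ->; case/and3P: xu => _ /negbTE; rewrite Fs => -> _; rewrite /spare_edge Dyx /= !andbF.
have fe : v = e -> [/\ F u v = false, spare y v = false & v <> x].
  rewrite /e; case yu: (spare y u) => -> .
    split; [|by rewrite /spare_edge eqxx|by move/eqP; rewrite eq_sym xy].
    by case/and3P: yu => _ /negbTE; rewrite Fs.
  by split=> //; [case: nF|case/and3P: xu => /eqP h _ _ /esym].
have f3 : F u v -> spare y v = false by move=> Fuv; apply/negbTE/(h3 _ _ xu Fuv).
case: (v =P e) => [ev|_].
  by have [-> -> /eqP/negbTE ->] := fe ev.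
case: (v =P x) => [ev|_]; first by have [-> ->] := fx ev.
by case Fuv: (F u v); [rewrite f3|case: (spare y v)].
Qed.

Lemma degree_reach p : p \in reach x -> degree F p + (p == y) = a.
Proof.
move=> px; case: nF => _ _ _ /(_ p).
by case: eqP => [e|_]; [move: notin_reach; rewrite -{1}e px|rewrite addn0].
Qed.

Lemma sum_reach :
  \sum_(p in reach x) \sum_u (F p u && spare x u : nat) = a * #|spares x|.
Proof.
rewrite exchange_big /= cardE_sum big_distrr; apply: eq_bigr => u _ /=.
rewrite inE; case xu: (spare x u); last by rewrite muln0 big1 // => p _; rewrite andbF.
rewrite muln1 -(degree_spare xu) degreeE big_mkcond; apply: eq_bigr => p _ /=.
case: ifP => [_|/negP np]; first by rewrite andbT Fs.
by case Fup: (F u p) => //; case: np; apply: spare_reach Fup.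
Qed.

(** No spare edge joins [p] to [reach y], so every other element of [reach y] is a neighbour of [p]
    in [F] or in [D]. As [spares x] and [reach y] are disjoint, the [F]-neighbours of [p] in these
    two sets number at most [degree F p] together. *)
Lemma row_bound p : p \in reach x ->
  \sum_u (F p u && spare x u : nat) + #|reach y| + (p == y)
  <= a + \sum_q ((q \in reach y) && D p q : nat) + (p \in reach y).
Proof.
move=> px; have [_ _ _ h3' h5] := xyS.
rewrite -(degree_reach px) -[X in _ <= X]addnA -[X in _ <= X]addnAC leq_add2r.
have -> : (p \in reach y : nat) = \sum_v ((v == p) && (p \in reach y) : nat).
  by rewrite sum_delta_and.
rewrite degreeE cardE_sum addnA -!big_split; apply: leq_sum => v _ /=.
case vQ: (v \in reach y); last by rewrite addn0; case: (F p v) => //=; lia.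
have /existsP[w /andP[yw Fwv]] : [exists w, spare y w && F w v] by move: vQ; rewrite inE.
have/reachP[u xu Fup] := px.
have := h5 _ _ _ _ xu Fup yw Fwv.
rewrite (negbTE (h3' _ _ yw Fwv)) andbF /spare_edge.
case: (v =P p) => [ev _|ne]; first by rewrite -ev vQ /=; lia.
by rewrite eq_sym (introF eqP ne) /=; case: (F p v) => //=; case: (D p v).
Qed.

Definition cross := \sum_p \sum_q ([&& p \in reach x, q \in reach y & D p q] : nat).

Lemma cross_rows :
  cross = \sum_(p in reach x) \sum_q ((q \in reach y) && D p q : nat).
Proof.
rewrite [RHS]big_mkcond; apply: eq_bigr => p _.
by case: (p \in reach x) => //=; apply: big1.
Qed.

Lemma reach_bound :
  a * #|spares x| + #|reach x| * #|reach y| + (y \in reach x)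
  <= a * #|reach x| + cross + #|reach x :&: reach y|.
Proof.
have := leq_sum (index_enum T) row_bound.
rewrite !big_split /= sum_reach !sum_nat_const -cross_rows [_ * a]mulnC.
congr (_ + _ <= _ + _).
  rewrite big_mkcond /= -(sum_delta_and y (fun p => p \in reach x)).
  by apply: eq_bigr => p _; case: (p == y); case: (p \in reach x).
rewrite cardE_sum big_mkcond /=; apply: eq_bigr => p _.
by rewrite in_setI; case: (p \in reach x).
Qed.

Lemma cross_bound :
  cross + degree D x + degree D y
    + (y \notin reach x) * degree D y + (x \notin reach y) * degree D x
  <= \sum_v degree D v + 1 + ((y \notin reach x) && (x \notin reach y)).
Proof.
apply: edge_count => //; first exact: notin_reach.
by apply/negP; rewrite inE => /existsP[w /andP[/and3P[_ /negP yw _]]]; rewrite Fs.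
Qed.

End Pair.

End Stuck.

Arguments reachP {T D F x p}.

(** * Sparsity of [D] against the counts *)

Section Contradiction.
Variables (T : finType) (D F : rel T) (a k : nat).
Hypotheses (Ds : symmetric D) (Di : irreflexive D) (cT : #|T| = a + k + 1).
Hypotheses (sumD : \sum_v degree D v + 2 <= #|T| + k + (a == 1)).
Hypothesis maxD : forall v, degree D v <= k.
Implicit Types (x y u v w p q : T).

Local Notation spare := (spare_edge D F).
Local Notation stuck := (stuck D F a).
Local Notation reach := (reach D F).
Local Notation spares := (spares D F).

Lemma spares_gt0 x y : stuck x y -> exists u, spare x u.
Proof.
move=> S; have /card_gt0P[u] : 0 < #|spares x|.
  by have := card_spares Ds Di cT S; have := maxD x; lia.
by rewrite inE; exists u.
Qed.

(** Here [F] is a matching that misses exactly [x] and [y]. So [reach x] is at least as large as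
    [spares x] and avoids [spares y], [x] and [y], which makes [degree D x + degree D y] at least
    [k + 2]. The edges of [D] at these two ends are then already too many. *)
Lemma stuck_one x y : a = 1 -> stuck x y -> False.
Proof.
move=> a1 S; have S' := stuckC Ds S; have [Dxy nF _ _ _] := S.
have xy : x != y by apply/eqP => e; rewrite e Di in Dxy.
have cA := card_spares Ds Di cT S; have cB := card_spares Ds Di cT S'.
have lA : #|spares x| <= #|reach x|.
  rewrite -[#|spares x|]mul1n -{1}a1 -(sum_reach S) -sum1_card.
  apply: leq_sum => p px; rewrite -{1}a1 -(degree_reach S px) degreeE.
  by apply: leq_trans (leq_addr _ _); apply: leq_sum => u _; case: (F p u) => /=; rewrite ?leq_b1.
have yP : y \notin reach x.
  apply/negP => yx; have := degree_reach S yx; rewrite eqxx.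
  have [u xu Fuy] := reachP yx.
  have : 0 < degree F y by rewrite card_gt0; apply/set0Pn; exists u; rewrite inE; case: nF => ->.
  lia.
have : #|reach x| + #|spares y| + 1 + 1 <= #|T|.
  rewrite -{1}(sum_delta x) -(sum_delta y) -sum_one !cardE_sum -!big_split.
  apply: leq_sum => v _ /=.
  have xP := notin_reach S.
  have h : v \in reach x -> v \notin spares y.
    by move=> vx; apply/negP; rewrite inE => /(spare_notin_reach S); rewrite vx.
  case: (v =P x) => [->|_].
    rewrite (negbTE xP) (negbTE xy) inE /spare_edge.
    by rewrite [D y x]Ds Dxy !andbF.
  case: (v =P y) => [->|_]; first by rewrite (negbTE yP) inE /spare_edge eqxx.
  by case vx: (v \in reach x); [rewrite (negbTE (h vx))|case: (_ \in _)].
have := @edge_count T D Ds Di x y set0 set0 Dxy.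
rewrite !inE => /(_ isT isT).
have -> : \sum_p \sum_q ([&& p \in set0, q \in set0 & D p q] : nat) = 0.
  by apply: big1 => p _; apply: big1 => q _; rewrite inE.
move: sumD; rewrite cT a1 /=; lia.
Qed.

(** [reach_bound] bounds [cross] from below and [cross_bound] from above. They clash unless
    [reach y] has exactly [a] elements, [y] is in [reach x] and [x] is in [reach y]; in that case
    [row_bound] is sharpened by one. *)
Lemma stuck_irregular x y : 1 < a -> stuck x y ->
  degree D x < k -> degree D x <= degree D y -> False.
Proof.
move=> a1 S dxk dxy; have S' := stuckC Ds S; have [Dxy nF h3 h3' h5] := S.
have Fs : symmetric F by case: nF.
have cA := card_spares Ds Di cT S; have cB := card_spares Ds Di cT S'.
have dx := maxD x; have dy := maxD y.
have dx2 := degree_end_ge2 Ds Di cT S' dy; have dy2 := degree_end_ge2 Ds Di cT S dx.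
have CB := cross_bound Ds Di S; have RB := reach_bound Ds Di cT S.
have [w0 yw0] := spares_gt0 S'.
have Qa := card_reach S' yw0.
have xP := notin_reach S; have yQ := notin_reach S'.
have sD : \sum_v degree D v + 2 <= #|T| + k by move: sumD; rewrite (gtn_eqF a1) addn0.
have cP : #|reach x :&: reach y| + (y \in reach x) <= #|reach x|.
  rewrite -(sum_delta_and y (fun v => v \in reach x)) !cardE_sum -big_split.
  apply: leq_sum => v _ /=; rewrite in_setI.
  by case: eqP => [->|_]; rewrite ?(negbTE yQ) ?andbF //; case: (v \in _); case: (v \in _).
have cQ : #|reach x :&: reach y| + (x \in reach y) <= #|reach y|.
  rewrite -(sum_delta_and x (fun v => v \in reach y)) !cardE_sum -big_split.
  apply: leq_sum => v _ /=; rewrite in_setI.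
  by case: eqP => [->|_]; rewrite ?(negbTE xP) //; case: (v \in _); case: (v \in _).
set j := k - degree D x; have ej : #|spares x| = j + 1 by lia.
have aj : 2 * j <= a * j by rewrite leq_mul2r a1 orbT.
(* This is [(a - 2) * (j - 1) >= 0]. *)
have aj2 : a + 2 * j <= a * j + 2.
  have [a' ea] : exists a', a = a' + 2 by exists (a - 2); lia.
  have [j' ej'] : exists j', j = j' + 1 by exists (j - 1); lia.
  by rewrite ea ej'; lia.
rewrite ej mulnDr muln1 in RB.
case: (ltnP a #|reach y|) => [Qgt|Qle].
  have m1 : #|reach x| * (a + 1) <= #|reach x| * #|reach y| by rewrite leq_mul2l addn1 Qgt orbT.
  rewrite mulnDr muln1 [_ * a]mulnC in m1.
  case: (y \in reach x) RB CB cP; case: (x \in reach y) cQ => /=; rewrite ?mul1n ?mul0n; lia.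
have eQ : #|reach y| = a by lia.
rewrite eQ [_ * a]mulnC in RB.
case yP: (y \in reach x); last first.
  rewrite yP in RB CB cP.
  rewrite /= ?mul1n in CB; case: (x \in reach y) cQ CB => /=; rewrite ?mul1n ?mul0n; lia.
case xQ: (x \in reach y); last first.
  rewrite yP in RB CB cP; rewrite xQ in CB cQ; rewrite /= ?mul1n in RB CB cP cQ; lia.
(* Both sets have [a] elements, so the [F]-neighbourhood of each [w] in [spares y] is all of
   [reach y]. *)
have FQ w q : spare y w -> q \in reach y -> F w q.
  move=> yw; have sub : [set q | F w q] \subset reach y.
    by apply/subsetP => z; rewrite inE; apply: (spare_reach yw).
  have := subset_cardP _ sub; rewrite -/(degree F w) (degree_spare S' yw) eQ.
  by move=> /(_ erefl) <-; rewrite inE.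
have BA w : spare y w -> spare x w = false.
  by move=> yw; rewrite /spare_edge [F x w]Fs FQ ?andbF.
have BQ w : spare y w -> w \notin reach y.
  move=> yw; apply/negP => wQ.
  have [u xu Fuy] := reachP yP.
  by have := h5 _ _ _ _ xu Fuy yw0 (FQ _ _ yw0 wQ); rewrite yw.
(* The term [(p \in reach y)] of [row_bound] is saved: for such a [p], the vertex [w0] is an
   [F]-neighbour in neither [spares x] nor [reach y]. *)
have row p : p \in reach x -> \sum_u (F p u && spare x u : nat) + a + (p == y)
     <= a + \sum_q ((q \in reach y) && D p q : nat).
  move=> px; have := row_bound Ds Di cT S px; rewrite eQ.
  case pQ: (p \in reach y); last by rewrite addn0.
  move=> _; rewrite -{1}eQ -(degree_reach S px).
  rewrite [X in _ <= X]addnAC leq_add2r -(leq_add2r 1) -{1}(sum_delta w0) -(sum_delta p).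
  rewrite degreeE cardE_sum -!big_split; apply: leq_sum => v _ /=.
  case: (v =P w0) => [->|_].
    by rewrite BA // (negbTE (BQ _ yw0)) andbF Fs FQ //=; case: (w0 == p).
  case vQ: (v \in reach y); last by case: (F p v); case: (spare x v); case: (v == p).
  have [w yw Fwv] := reachP vQ; have [u xu Fup] := reachP px.
  have := h5 _ _ _ _ xu Fup yw Fwv.
  rewrite (negbTE (h3' _ _ yw Fwv)) andbF /spare_edge.
  case: (v =P p) => [ev _|ne]; first by case: (F p v); case: (D p v).
  by rewrite eq_sym (introF eqP ne) /=; case: (F p v) => //=; case: (D p v).
have := leq_sum (index_enum T) row.
rewrite !big_split /= (sum_reach S) -cross_rows !sum_nat_const [_ * a]mulnC ej mulnDr muln1.
have : (y \in reach x) <= \sum_(p in reach x) (p == y).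
  by rewrite yP (bigD1 y) //= eqxx.
rewrite yP xQ /= in CB *; lia.
Qed.

(** All elements of [reach x] have degree [k] in [D]. Together with [x] they are at least [a + 1]
    vertices, and [(a + 1) * k] exceeds the allowed degree sum when [a] and [k] are at least 2. *)
Lemma stuck_regular x y : 1 < a -> stuck x y ->
  (forall v, degree D v = 0 \/ degree D v = k) -> degree D x = k -> degree D y = k -> False.
Proof.
move=> a1 S reg dx dy; have S' := stuckC Ds S; have [Dxy nF h3 h3' h5] := S.
have Fs : symmetric F by case: nF.
have Fi : irreflexive F by case: nF.
have cA := card_spares Ds Di cT S; have cB := card_spares Ds Di cT S'.
have k2 : 1 < k by rewrite -dy; apply: (degree_end_ge2 Ds Di cT S).
have [w0 yw0] := spares_gt0 S'; have [u0 xu0] := spares_gt0 S.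
have Qa := card_reach S' yw0; have Pa := card_reach S xu0.
have xP := notin_reach S; have yQ := notin_reach S'.
have uA u : spare x u -> u = u0.
  have/eqP/cards1P[z e] : #|spares x| = 1 by lia.
  have : u0 \in spares x by rewrite inE.
  move=> + xu; have : u \in spares x by rewrite inE.
  by rewrite e !inE => /eqP -> /eqP ->.
have uB w : spare y w -> w = w0.
  have/eqP/cards1P[z e] : #|spares y| = 1 by lia.
  have : w0 \in spares y by rewrite inE.
  move=> + yw; have : w \in spares y by rewrite inE.
  by rewrite e !inE => /eqP -> /eqP ->.
(* If [p] were isolated in [D], then [F] would join it to [u0], to all of [reach y] except [p], and,
   if [p] is in [reach y], to one more vertex [e]: more than [a] neighbours. *)
have supp p : p \in reach x -> degree D p = k.
  move=> px; case: (reg p) => // p0.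
  have Dp v : D p v = false.
    by apply/negP => Dpv; have /eqP := p0; rewrite cards_eq0 => /eqP/setP/(_ v); rewrite !inE Dpv.
  have py : (p == y) = false by apply/negP => /eqP e; rewrite e dy in p0; lia.
  have dFp := degree_reach S px; rewrite py addn0 in dFp.
  have [u xu Fup] := reachP px; rewrite (uA _ xu) in Fup.
  have Qu : u0 \notin reach y by apply: (spare_notin_reach S').
  have Qw : w0 \notin reach y.
    by apply/negP => /reachP[w /uB -> ]; rewrite Fi.
  have FQ v : v \in reach y -> v != p -> F p v.
    move=> vQ vp; have [w yw Fwv] := reachP vQ.
    have := h5 _ _ _ _ xu0 Fup yw Fwv.
    by rewrite /spare_edge eq_sym vp Dp andbT negbK.
  case pQ: (p \in reach y); last first.
    suff : #|reach y| + 1 <= a by rewrite addn1 ltnNge Qa.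
    rewrite -dFp -(sum_delta u0) degreeE cardE_sum -big_split; apply: leq_sum => v _ /=.
    case: (v =P u0) => [->|_]; first by rewrite (negbTE Qu) Fs Fup.
    case vQ: (v \in reach y) => //; rewrite FQ //.
    by apply/eqP => e; rewrite e pQ in vQ.
  have [w yw Fwp] := reachP pQ; rewrite (uB _ yw) in Fwp.
  (* [w0] is an [F]-neighbour of [p], but not a new one if it equals [u0]. Then [x] is: otherwise
     [xp] would be spare, forcing [p = u0]. *)
  pose e := if u0 == w0 then x else w0.
  have [eQ eu Fpe] : [/\ e \notin reach y, e != u0 & F p e].
    rewrite /e; case: eqP => [uw|/eqP uw].
      split; last first.
      - apply/negPn/negP => Fpx.
        have : spare x p.
          rewrite /spare_edge [F x p]Fs Fpx [D x p]Ds Dp andbT.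
          by apply/eqP => e'; move: xP; rewrite {1}e' px.
        by move/uA => e'; rewrite e' Fi in Fup.
      - by case/and3P: xu0.
      apply/negP => /reachP[w' /uB ->]; rewrite -uw Fs.
      by case/and3P: xu0 => _ /negbTE ->.
    by split=> //; [rewrite eq_sym|rewrite Fs].
  suff : #|reach y| + 1 + 1 <= a + 1 by rewrite leq_add2r addn1 ltnNge Qa.
  rewrite -dFp -{1}(sum_delta u0) -{1}(sum_delta e) -(sum_delta p) degreeE cardE_sum.
  rewrite -!big_split; apply: leq_sum => v _ /=.
  case: (v =P u0) => [->|_].
    by rewrite (negbTE Qu) [u0 == e]eq_sym (negbTE eu) Fs Fup; case: (u0 == p).
  case: (v =P e) => [->|_]; first by rewrite (negbTE eQ) Fpe.
  case vQ: (v \in reach y) => //; case vp: (v == p); first by case: (F p v).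
  by rewrite FQ // vp.
have : \sum_v ((v \in reach x) * k + (v == x) * k) <= \sum_v degree D v.
  apply: leq_sum => v _; case: (v =P x) => [->|_].
    by rewrite (negbTE xP) dx mul1n.
  by case vP: (v \in reach x); rewrite ?(supp v vP) /= ?mul1n ?mul0n ?addn0 ?leqnn.
rewrite big_split -!big_distrl /= -cardE_sum sum_delta.
have pk : (a + 1) * k <= (#|reach x| + 1) * k by rewrite leq_mul2r leq_add2r Pa orbT.
have ak : a + k <= a * k.
  have [a' ea] : exists a', a = a' + 2 by exists (a - 2); lia.
  have [k' ek] : exists k', k = k' + 2 by exists (k - 2); lia.
  by rewrite ea ek; lia.
by move: sumD; rewrite cT (gtn_eqF a1); lia.
Qed.

End Contradiction.

(** * Circulant regular graphs *)

Lemma sum_interval n c d : d <= n -> \sum_(i < n) ((c <= i < d) : nat) = d - c.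
Proof.
suff -> : \sum_(i < n) ((c <= i < d) : nat) = minn n d - c by move=> dn; congr (_ - _); lia.
elim: n => [|n IH]; first by rewrite big_ord0; lia.
rewrite big_ord_recr /= IH; lia.
Qed.

Lemma circulant_regular m (S : {set 'I_m.+1}) :
  let F := fun i j : 'I_m.+1 => (j - i)%R \in S in
  forall i, degree F i = #|S|.
Proof.
move=> F i.
have inj : injective (fun j => (j - i)%R) := @GRing.addIr _ (- i)%R.
by rewrite -(card_preimset S inj); apply: eq_card => j; rewrite !inE.
Qed.

(* An interval [c, n - c] of residues, without its midpoint if [n] and [a] are even. *)
Lemma symmetric_connection_set m a : a < m.+1 -> ~~ odd (m.+1 * a) ->
  exists S : {set 'I_m.+1},
    [/\ #|S| = a, ord0 \notin S & forall s, ((- s)%R \in S) = (s \in S)].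
Proof.
move=> am odd_ma.
have oppE (s : 'I_m.+1) : s != ord0 -> ((- s)%R : nat) = m.+1 - s.
  move=> s0; have s0' : 0 < s by rewrite lt0n.
  by rewrite /= modn_small //; lia.
pose I c := [set s : 'I_m.+1 | c <= s < m.+2 - c].
have I0 c : 0 < c -> ord0 \notin I c by move=> c0; rewrite inE /=; lia.
have IN c s : 0 < c -> ((- s)%R \in I c) = (s \in I c).
  move=> c0; have [->|s0] := eqVneq s ord0; first by rewrite GRing.oppr0.
  by rewrite !inE oppE //; have := ltn_ord s; lia.
have cI c : 0 < c -> #|I c| = m.+2 - c - c.
  move=> c0; rewrite cardE_sum -(@sum_interval m.+1); last lia.
  by apply: eq_bigr => s _; rewrite inE.
have [odd_mS|ev] := boolP (odd (m.+2 - a)).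
  have [em ea] : ~~ odd m.+1 /\ ~~ odd a.
    move: odd_mS odd_ma; rewrite oddB; last by lia.
    by rewrite oddM /=; case: (odd m); case: (odd a).
  pose c := (m.+1 - a)./2; pose h : 'I_m.+1 := inord (m.+1)./2.
  have c0 : 0 < c by rewrite /c; lia.
  have hE : (h : nat) = (m.+1)./2 by rewrite inordK //; lia.
  have hI : h \in I c by rewrite inE hE /c; lia.
  have hh : (- h)%R = h.
    apply: val_inj; change (nat_of_ord (- h)%R = nat_of_ord h).
    have h0 : h != ord0 by apply/eqP => e; move: hE; rewrite e /=; lia.
    by rewrite oppE // hE; lia.
  exists (I c :\ h); split.
  - have := cardsD1 h (I c); rewrite hI cI // add1n.
    have -> : m.+2 - c - c = a.+1 by rewrite /c; lia.
    by case.
  - by rewrite in_setD1 negb_and I0 ?orbT.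
  - by move=> s; rewrite in_setD1 IN // in_setD1 -{1}hh (inj_eq GRing.oppr_inj).
pose c := (m.+2 - a)./2.
have c0 : 0 < c by rewrite /c; lia.
by exists (I c); split; [rewrite cI // /c; lia|exact: I0|move=> s; exact: IN].
Qed.

Lemma regular_graph_exists (T : finType) a : a < #|T| -> ~~ odd (#|T| * a) ->
  exists F : rel T, [/\ symmetric F, irreflexive F & forall v, degree F v = a].
Proof.
move=> aT odd_T; have [m cT] : exists m, #|T| = m.+1 by exists #|T|.-1; lia.
rewrite cT in aT odd_T; have [S [cS S0 SN]] := symmetric_connection_set aT odd_T.
pose f (v : T) := cast_ord cT (enum_rank v).
have fb : bijective f.
  exists (fun i => enum_val (cast_ord (esym cT) i)) => v; rewrite /f.
    by rewrite cast_ordK enum_rankK.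
  by rewrite enum_valK cast_ordKV.
exists (fun v w => (f w - f v)%R \in S); split.
- by move=> v w; rewrite -SN GRing.opprB.
- by move=> v; rewrite GRing.subrr; apply/negbTE.
move=> v; rewrite -cS -(circulant_regular S (f v)) /degree.
rewrite -(on_card_preimset (onW_bij _ fb)).
by apply: eq_card => w; rewrite !inE.
Qed.

(** * Factors in graphs with sparse complement *)

Lemma regular_factor_of_sparse_complement (T : finType) (D : rel T) a k :
  symmetric D -> irreflexive D -> #|T| = a + k + 1 -> 0 < a ->
  ~~ odd (#|T| * a) -> (forall v, degree D v <= k) ->
  \sum_v degree D v + 2 <= #|T| + k + (a == 1) ->
  exists F, regular_factor D a F.
Proof.
move=> Ds Di cT a0 odd_Ta; move: D Ds Di.
(* Strong induction on the degree sum of [D] replaces the choice of an edge-minimal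
   counterexample. *)
suff IH N (D : rel T) : \sum_v degree D v < N -> symmetric D -> irreflexive D ->
    (forall v, degree D v <= k) -> \sum_v degree D v + 2 <= #|T| + k + (a == 1) ->
    exists F, regular_factor D a F.
  by move=> D; apply: (IH _ D (leqnn _)).
elim: N D => // N IHN D sN Ds Di maxD sumD.
apply: boolp.contrapT => nof.
have {}nof F : ~ regular_factor D a F by move=> h; apply: nof; exists F.
have near x y : D x y -> exists F, stuck D F a x y.
  move=> Dxy; have xy : x != y by apply/eqP => e; rewrite e Di in Dxy.
  pose D' := toggle D x y.
  have D's : symmetric D' by exact: toggle_sym.
  have D'i : irreflexive D' by exact: toggle_irr.
  have D'd v : degree D' v + (v == x) + (v == y) = degree D v.
    exact: degree_toggle_del.
  have sD' : \sum_v degree D' v + 2 = \sum_v degree D v.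
    rewrite -(eq_bigr _ (fun v _ => D'd v)) !big_split /= !sum_delta; lia.
  have [|v||F [Fs Fi FD Fd]] := IHN D' _ D's D'i.
  - by lia.
  - by have := maxD v; have := D'd v; lia.
  - by lia.
  have FD' v w : ~ (v = x /\ w = y) -> ~ (v = y /\ w = x) -> F v w -> ~~ D v w.
    by move=> h1 h2 /FD; rewrite /D' toggle_other.
  (* [F] avoids [D] without [xy]; if it also avoided [xy], it would be a regular factor for [D]. *)
  have Fxy : F x y.
    apply/negPn/negP => nFxy; case: (nof F); split=> // v w Fvw.
    by apply: FD' => // -[e1 e2]; subst; [|rewrite Fs in Fvw]; rewrite Fvw in nFxy.
  exists (toggle F x y); apply: no_factor_stuck => //; split.
  - exact: toggle_sym.
  - exact: toggle_irr.
  - move=> v w; rewrite /toggle; case h: (_ || _); rewrite ?addbT ?addbF.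
      by case/orP: h => /andP[/eqP-> /eqP->]; rewrite ?[F y x]Fs Fxy.
    by move=> Fvw; apply: FD' => // -[e1 e2]; subst; rewrite !eqxx ?orbT in h.
  by move=> v; rewrite degree_toggle_del.
have [[x [y Dxy]]|empty] := boolp.pselect (exists x y, D x y); last first.
  have aT : a < #|T| by lia.
  have [F [Fs Fi Fd]] := regular_graph_exists aT odd_Ta.
  apply: (nof F); split=> // v w _; apply/negP => Dvw.
  by apply: empty; exists v, w.
have [a1|a1] := eqVneq a 1.
  by have [F S] := near _ _ Dxy; apply: (stuck_one Ds Di cT sumD a1 S).
have {}a1 : 1 < a by lia.
have supp_deg v : degree D v != 0 -> exists w, D v w.
  by rewrite cards_eq0 => /set0Pn[w]; rewrite inE; exists w.
have [[x' [y' [Dxy' dx']]]|reg] := boolp.pselect (exists x y, D x y /\ degree D x < k).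
  (* The end of smaller degree must come first; its degree is below [k] in either case. *)
  have [dxy|dyx] := leqP (degree D x') (degree D y').
    have [F S] := near _ _ Dxy'.
    exact: (stuck_irregular Ds Di cT sumD maxD a1 S).
  have [F S] := near y' x' (etrans (Ds _ _) Dxy').
  by apply: (stuck_irregular Ds Di cT sumD maxD a1 S); lia.
have {}reg v w : D v w -> degree D v = k.
  move=> Dvw; apply/eqP; rewrite eqn_leq maxD leqNgt; apply/negP => lt.
  by apply: reg; exists v, w.
have [F S] := near _ _ Dxy.
apply: (stuck_regular Ds Di cT sumD maxD a1 S).
- move=> v; have [->|/supp_deg[w Dvw]] := eqVneq (degree D v) 0; first by left.
  by right; apply: reg Dvw.
- exact: reg Dxy.
- by apply: (reg y x); rewrite Ds.
Qed.

Lemma sum_option (T : finType) (f : option T -> nat) :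
  \sum_v f v = f None + \sum_v f (Some v).
Proof.
rewrite (bigD1 None) //=; congr (_ + _).
rewrite (reindex_omap Some id) /= => [|[v|] //]; by apply: eq_bigl => v; rewrite eqxx.
Qed.

(* The complement of the cone over [G] when [D] is the complement of [G]. *)
Definition cone_compl (T : finType) (D : rel T) : rel (option T) := fun v w =>
  if v is Some v' then if w is Some w' then D v' w' else false else false.

Lemma factor_of_sparse_complement (T : finType) (D : rel T) a b k :
  symmetric D -> irreflexive D -> #|T| = a + k + 1 -> 0 < a -> a <= b ->
  (a = b -> ~~ odd (#|T| * a)) -> (forall v, degree D v <= k) ->
  \sum_v degree D v + 2 <= #|T| + k + (a == 1) ->
  exists F, [/\ symmetric F, irreflexive F, forall v w, F v w -> ~~ D v w
    & forall v, a <= degree F v <= b].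
Proof.
move=> Ds Di cT a0 ab par maxD sumD.
have [odd_Ta|ev] := boolP (odd (#|T| * a)); last first.
  have [F [Fs Fi FD Fd]] := regular_factor_of_sparse_complement Ds Di cT a0 ev maxD sumD.
  by exists F; split=> // v; rewrite Fd leqnn.
have {par ab}ab : a < b.
  by rewrite ltn_neqAle ab andbT; apply/eqP => /par; rewrite odd_Ta.
pose D' := cone_compl D.
have dN : degree D' None = 0 by rewrite degreeE big1.
have dS v : degree D' (Some v) = degree D v.
  by rewrite !degreeE sum_option.
have cT' : #|{: option T}| = (a + 1) + k + 1 by rewrite card_option cT; lia.
have [||||||F [Fs Fi FD Fd]] := @regular_factor_of_sparse_complement _ D' (a + 1) k _ _ cT'.
- by move=> [v|] [w|] //=; apply: Ds.
- by move=> [v|] //=; apply: Di.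
- by lia.
- by rewrite card_option; move: odd_Ta; rewrite !oddM /= addn1 /= => /andP[-> ->].
- by case=> [v|]; rewrite ?dS ?dN.
(* The bonus [(a == 1)] is lost on passing to [a + 1], and the added vertex makes up for it. *)
- by rewrite sum_option dN (eq_bigr _ (fun v _ => dS v)) card_option; lia.
exists (fun v w => F (Some v) (Some w)); split.
- by move=> v w; apply: Fs.
- by move=> v; apply: Fi.
- by move=> v w /FD.
move=> v; have := Fd (Some v); rewrite !degreeE sum_option.
by have := leq_b1 (F (Some v) None); lia.
Qed.

Import Order.TTheory GRing.Theory Num.Theory.
Local Open Scope ring_scope.
Local Open Scope sesquilinear_scope.

(** * Rayleigh quotients *)

Lemma spectral_diag_eigenvalue (R : realType) n (B : 'M[R[i]]_n) i :
  B \is hermsymmx -> eigenvalue B (spectral_diag B 0 i).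
Proof.
move=> BH; have U := spectral_unit B.
apply/eigenvalueP; exists (row i (spectralmx B)); last first.
  apply/eqP => r0; move: U; rewrite -row_free_unit => /row_free_inj.
  have e : delta_mx 0 i *m spectralmx B = 0 *m spectralmx B :> 'rV_n.
    by rewrite -rowE r0 mul0mx.
  move=> /(_ _ _ _ e)/matrixP/(_ 0 i); rewrite !mxE !eqxx => /eqP.
  by rewrite oner_eq0.
have /hermitian_normalmx/orthomx_spectralP E := BH.
by rewrite [X in _ *m X = _]E rowE !mulmxA mulmxK// -(rowE _ (diag_mx _))
  row_diag_mx -scalemxAl.
Qed.

(** In a unitary eigenbasis over [R[i]] the quadratic form is the sum of the eigenvalues weighted by
    the squared moduli of the coordinates [y]. The eigenvalues are real, so the bound [m] over [R]
    applies to them. *)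
Lemma symmetric_rayleigh (R : realType) n (A : 'M[R]_n) (m : R) (x : 'rV[R]_n) :
  A^T = A -> (forall l, eigenvalue A l -> l <= m) ->
  (x *m A *m x^T) 0 0 <= m * (x *m x^T) 0 0.
Proof.
move=> As Am; pose toC := real_complex R; pose B : 'M[R[i]]_n := map_mx toC A.
have BR : B \is a mxOver Num.real.
  by apply/mxOverP => i j; rewrite mxE; apply/complex_realP; exists (A i j).
have BS : B \is symmetricmx.
  apply/is_hermitianmxP; rewrite expr0 scale1r; apply/matrixP => i j.
  by rewrite !mxE -[in LHS]As mxE.
have BH := realsym_hermsym BS BR.
have /hermitian_normalmx/orthomx_spectralP E := BH.
set P := spectralmx B in E; set d := spectral_diag B in E.
have Pu : P \is unitarymx := spectral_unitarymx B.
pose X : 'rV[R[i]]_n := map_mx toC x; pose y := X *m P ^t*.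
have XT : X ^t* = X^T.
  by apply/matrixP => i j; rewrite !mxE; apply/CrealP/complex_realP; exists (x j i).
have yT : y ^t* = P *m X^T.
  rewrite /y trmx_mul map_mxM XT; congr (_ *m _).
  exact: trmxCK.
have yy : y *m (P *m X^T) = X *m X^T.
  by rewrite mulmxA /y -invmx_unitary // mulmxKV // unitarymx_unit.
have yBy : y *m diag_mx d *m (P *m X^T) = X *m B *m X^T.
  by rewrite [B]E invmx_unitary // !mulmxA.
have dm i : d 0 i <= toC m.
  have /mxOverP/(_ 0 i)/complex_realP[l lE] := hermitian_spectral_diag_real BH.
  rewrite /d lE lecR; apply: Am; rewrite -(eigenvalue_map (real_complex R)).
  by have := spectral_diag_eigenvalue i BH; rewrite lE.
have -> : (x *m A *m x^T) 0 0 = complex.Re ((X *m B *m X^T) 0 0).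
  by rewrite /X /B map_trmx -!map_mxM [in RHS]mxE.
have -> : m * (x *m x^T) 0 0 = complex.Re (toC m * (X *m X^T) 0 0).
  by rewrite /X map_trmx -!map_mxM [in RHS]mxE -rmorphM.
have : (X *m B *m X^T) 0 0 <= toC m * (X *m X^T) 0 0.
  rewrite -yBy -yy -yT mul_mx_diag !mxE mulr_sumr; apply: ler_sum => i _.
  rewrite !mxE mulrAC mulrC ler_wpM2r //.
  by rewrite mul_conjC_ge0.
by rewrite lecE => /andP[].
Qed.

(** * The adjacency operator and its nonnegative eigenvectors *)

Section Adjacency.
Variables (R : realType) (G : sgraph).
Implicit Types f g : G -> R.

Local Notation rho := (spectral_radius R G).

(** Functions on vertices stand for row vectors, so that one [f] can be tested on two graphs with
    the same vertex set. *)
Definition adj f (v : G) : R := \sum_(w | edge v w) f w.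
Definition dot f g : R := \sum_v f v * g v.

Lemma adjE f v : adj f v = \sum_w (edge v w)%:R * f w.
Proof.
by rewrite /adj big_mkcond; apply: eq_bigr => w _; case: edge; rewrite ?mul1r ?mul0r.
Qed.

Definition vec f : 'rV[R]_#|G| := \row_i f (enum_val i).

Lemma sum_enum_val (F : G -> R) : \sum_(i < #|G|) F (enum_val i) = \sum_v F v.
Proof. by rewrite [RHS]big_enum_val. Qed.

Lemma vec_adj f : vec f *m adjacency R G = vec (adj f).
Proof.
apply/rowP => j; rewrite !mxE adjE -sum_enum_val; apply: eq_bigr => i _.
by rewrite !mxE mulrC edge_sym.
Qed.

Lemma vec_dot f g : (vec f *m (vec g)^T) 0 0 = dot f g.
Proof.
by rewrite !mxE /dot -sum_enum_val; apply: eq_bigr => i _; rewrite !mxE.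
Qed.

Lemma vec_onto (x : 'rV[R]_#|G|) : vec (fun v => x 0 (enum_rank v)) = x.
Proof. by apply/rowP => i; rewrite mxE enum_valK. Qed.

Lemma vec_eq0 f : (vec f == 0) = [forall v, f v == 0].
Proof.
apply/eqP/forallP => [f0 v|f0].
  by have /rowP/(_ (enum_rank v)) := f0; rewrite !mxE enum_rankK => ->.
by apply/rowP => i; rewrite !mxE; apply/eqP.
Qed.

Lemma adj_eigenvalueP l : eigenvalue (adjacency R G) l <->
  exists2 f, (exists v, f v != 0) & forall v, adj f v = l * f v.
Proof.
split=> [/eigenvalueP[x xA x0]|[f [v fv0] fE]].
  exists (fun v => x 0 (enum_rank v)).
    apply/existsP; rewrite -negb_forall; apply: contra x0.
    by rewrite -vec_eq0 vec_onto.
  move=> v; move: xA; rewrite -{1}(vec_onto x) vec_adj => /rowP/(_ (enum_rank v)).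
  by rewrite !mxE enum_rankK.
apply/eigenvalueP; exists (vec f).
  by rewrite vec_adj; apply/rowP => i; rewrite !mxE fE.
by rewrite vec_eq0 negb_forall; apply/existsP; exists v.
Qed.

Hypothesis G_gt0 : (0 < #|G|)%N.

Lemma rayleigh f : dot f (adj f) <= rho * dot f f.
Proof.
have [_ rmax] := spectral_radius_max R G_gt0.
have As : (adjacency R G)^T = adjacency R G.
  by apply/matrixP => i j; rewrite !mxE edge_sym.
have := symmetric_rayleigh (vec f) As rmax.
by rewrite -mulmxA -[_ *m (vec f)^T]trmxK trmx_mul trmxK As vec_adj !vec_dot.
Qed.

Lemma dotC f g : dot f g = dot g f.
Proof. by apply: eq_bigr => v _; rewrite mulrC. Qed.

Lemma dot_adjC f g : dot f (adj g) = dot g (adj f).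
Proof.
rewrite /dot; under eq_bigr do rewrite adjE mulr_sumr.
rewrite exchange_big; apply: eq_bigr => w _; rewrite adjE mulr_sumr.
by apply: eq_bigr => v _; rewrite edge_sym; ring.
Qed.

Lemma dot_ge0 f : 0 <= dot f f.
Proof. by apply: sumr_ge0 => v _; rewrite -expr2 sqr_ge0. Qed.

Lemma dot_eq0 f : dot f f = 0 -> forall v, f v = 0.
Proof.
move=> /eqP; rewrite psumr_eq0 => [/allP h v|v _]; last by rewrite -expr2 sqr_ge0.
by have := h v (mem_index_enum _); rewrite -expr2 sqrf_eq0 => /eqP.
Qed.

Lemma dot_gt0 f v : f v != 0 -> 0 < dot f f.
Proof.
move=> fv; rewrite lt_def dot_ge0 andbT; apply: contra fv => /eqP/dot_eq0 ->//.
Qed.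

Lemma dot_expand f g t :
  dot (fun v => f v + t * g v) (fun v => f v + t * g v)
  = dot f f + 2 * t * dot f g + t ^+ 2 * dot g g.
Proof. by rewrite /dot !mulr_sumr -!big_split; apply: eq_bigr => v _ /=; ring. Qed.

Lemma dotDr f g h c : dot f (fun v => g v + c * h v) = dot f g + c * dot f h.
Proof. by rewrite /dot mulr_sumr -big_split; apply: eq_bigr => v _ /=; ring. Qed.

Lemma dot_adj_expand f g t :
  dot (fun v => f v + t * g v) (adj (fun v => f v + t * g v))
  = dot f (adj f) + 2 * t * dot g (adj f) + t ^+ 2 * dot g (adj g).
Proof.
have -> : dot (fun v => f v + t * g v) (adj (fun v => f v + t * g v))
    = dot (fun v => f v + t * g v) (fun v => adj f v + t * adj g v).
  apply: eq_bigr => v _; congr (_ * _).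
  by rewrite /adj mulr_sumr -big_split.
rewrite dotDr dotC [dot _ (adj g)]dotC !dotDr ![dot (adj _) _]dotC.
rewrite [dot f (adj g)]dot_adjC; ring.
Qed.

(* Perturb [f] along the residual [adj f - rho f]. *)
Lemma rayleigh_eq f : dot f (adj f) = rho * dot f f -> forall v, adj f v = rho * f v.
Proof.
move=> fE; pose r v := adj f v + (- rho) * f v.
suff r0 : dot r r = 0.
  by move=> v; have := dot_eq0 r0 v; rewrite /r => /eqP; rewrite mulNr subr_eq0 => /eqP.
pose s := dot r r; pose c := rho * dot r r - dot r (adj r).
have sE : s = dot r (adj f) - rho * dot f r by rewrite /s /r dotDr [dot _ f]dotC; ring.
have s0 : 0 <= s := dot_ge0 r.
have c0 : 0 <= c by rewrite /c subr_ge0 rayleigh.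
have key t : 2 * t * s <= t ^+ 2 * c.
  have := rayleigh (fun v => f v + t * r v).
  rewrite dot_adj_expand dot_expand fE sE /c; lra.
have c1 : 0 < c + 1 by lra.
(* The best [t] would be [s / c]; adding 1 avoids a zero denominator. The result is
   [2 * s ^+ 2 * (c + 1) <= s ^+ 2 * c], whence [s = 0]. *)
have := key (s / (c + 1)).
have -> : 2 * (s / (c + 1)) * s = (2 * s ^+ 2 * (c + 1)) / (c + 1) ^+ 2.
  by field; rewrite gt_eqF.
have -> : (s / (c + 1)) ^+ 2 * c = (s ^+ 2 * c) / (c + 1) ^+ 2.
  by field; rewrite gt_eqF.
rewrite ler_pM2r ?invr_gt0 ?exprn_gt0 // => h.
have : s ^+ 2 = 0 by have := sqr_ge0 s; nra.
by move=> /eqP; rewrite sqrf_eq0 => /eqP.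
Qed.

(** Replacing an eigenvector by its absolute value keeps [dot f f] and does not lower
    [dot f (adj f)]. The maximum of the Rayleigh quotient is thus attained, and [rayleigh_eq]
    applies. *)
Lemma nonneg_eigenvector : exists f, [/\ forall v, 0 <= f v, exists v, f v != 0
  & forall v, adj f v = rho * f v].
Proof.
have [/adj_eigenvalueP[f f0 fE] _] := spectral_radius_max R G_gt0.
exists (fun v => `|f v|); split=> //.
  by case: f0 => v fv; exists v; rewrite normr_eq0.
apply: rayleigh_eq; apply/le_anti; rewrite rayleigh /=.
have -> : dot (fun v => `|f v|) (fun v => `|f v|) = dot f f.
  by apply: eq_bigr => v _; rewrite -normrM ger0_norm // -expr2 sqr_ge0.
have <- : dot f (adj f) = rho * dot f f.
  by rewrite /dot mulr_sumr; apply: eq_bigr => v _; rewrite fE; ring.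
apply: ler_sum => v _; apply: le_trans (ler_norm _) _; rewrite normrM.
by rewrite ler_wpM2l // ler_norm_sum.
Qed.

End Adjacency.

Lemma sg_iso_sym (G H : sgraph) : sg_iso G H -> sg_iso H G.
Proof.
case=> f [g fK gK] fE; exists g; first by exists f.
by move=> x y; rewrite -fE !gK.
Qed.

Lemma sg_iso_eigenvalue (R : realType) (G H : sgraph) l :
  sg_iso G H -> eigenvalue (adjacency R G) l -> eigenvalue (adjacency R H) l.
Proof.
case=> f [g fK gK] fE /adj_eigenvalueP[phi [v phiv] phiE]; apply/adj_eigenvalueP.
exists (phi \o g); first by exists (f v); rewrite /= fK.
move=> w; rewrite /= -phiE /adj (reindex f) /=; last by exists g => ? _; rewrite ?fK ?gK.
by apply: eq_big => z; rewrite ?fK // -{1}(gK w) fE.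
Qed.

Lemma sg_iso_spectral_radius (R : realType) (G H : sgraph) :
  sg_iso G H -> spectral_radius R G = spectral_radius R H.
Proof.
move=> GH; congr (sup _); apply/classical_sets.seteqP; split=> l /=.
  exact: sg_iso_eigenvalue.
exact/sg_iso_eigenvalue/sg_iso_sym.
Qed.

(** * A spectral bound from the minimum degree *)

Section MinDegree.
Variables (R : realType) (G : sgraph) (a : nat).
Hypotheses (G_gt0 : (0 < #|G|)%N) (min_deg : forall v : G, (a <= degree (@edge G) v)%N).

Local Notation rho := (spectral_radius R G).
Local Notation deg v := ((degree (@edge G) v)%:R : R).

Lemma adj1E (v : G) : adj (fun=> 1 : R) v = deg v.
Proof. by rewrite adjE degreeE natr_sum; apply: eq_bigr => w _; rewrite mulr1. Qed.

(** Each of the [#|G| - 1 - deg v] vertices other than [v] and not adjacent to it takes at least [a]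
    of the degree sum. *)
Lemma adj_deg_bound (v : G) : adj (fun w => deg w) v <=
  (\sum_w degree (@edge G) w)%:R - deg v - a%:R * (#|G|%:R - 1 - deg v).
Proof.
have -> : #|G|%:R - 1 - deg v =
    \sum_w (1 - (w == v)%:R - (edge v w)%:R) :> R.
  rewrite !sumrB; congr (_ - _ - _).
  - by rewrite sumr_const.
  - by rewrite -natr_sum sum_delta.
  - by rewrite degreeE natr_sum.
have -> : deg v = \sum_w (w == v)%:R * deg w.
  rewrite (bigD1 v) //= eqxx mul1r big1 ?addr0 // => w /negbTE ->.
  by rewrite mul0r.
rewrite adjE natr_sum mulr_sumr -!sumrB; apply: ler_sum => w _.
have : a%:R <= deg w by rewrite ler_nat.
have := edge_irr v; case: (w =P v) => [->|_] e.
  by rewrite e /=; lra.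
by case: (edge v w) => /=; lra.
Qed.

(** Subtracting [(a - 1) * deg v] from [adj_deg_bound] cancels [deg v] on the right. The bound is
    then the same at all vertices and can be averaged with the weights [f]. *)
Lemma min_degree_bound : rho * (rho - (a%:R - 1)) <=
  (\sum_w degree (@edge G) w)%:R - a%:R * (#|G|%:R - 1).
Proof.
have [f [f0 [v0 fv0] fE]] := nonneg_eigenvector R G_gt0.
pose S := \sum_v f v; set M := _ - a%:R * _.
have S0 : 0 < S.
  rewrite /S (bigD1 v0) //= ltr_wpDr ?sumr_ge0 //.
  by rewrite lt_def fv0 f0.
have d1 : dot f (adj (fun=> 1)) = rho * S.
  rewrite dot_adjC /dot /S mulr_sumr; apply: eq_bigr => v _.
  by rewrite fE mul1r.
have d2 : dot f (adj (fun w => deg w)) = rho ^+ 2 * S.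
  rewrite dot_adjC expr2 -mulrA -d1 /dot mulr_sumr; apply: eq_bigr => v _.
  by rewrite fE adj1E; ring.
rewrite -(ler_pM2r S0).
have -> : rho * (rho - (a%:R - 1)) * S =
    dot f (fun v => adj (fun w => deg w) v + (- (a%:R - 1)) * adj (fun=> 1) v).
  by rewrite dotDr d1 d2; ring.
rewrite [M * S]mulr_sumr; apply: ler_sum => v _; rewrite mulrC ler_wpM2r //.
by have := adj_deg_bound v; rewrite adj1E /M; lra.
Qed.

End MinDegree.

(** * The extremal graph *)

Section Pendant.
Variables (T : finType) (u : T) (N : {set T}).
Hypothesis uN : u \notin N.

(* [K_{a-1} v (K_{n-a} u K_1)] on the vertex set [T]: [u] is the vertex of [K_1]
   and [N] the vertex set of [K_{a-1}]. *)
Definition pendant_edge : rel T := fun v w =>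
  [&& v != w, (v == u) ==> (w \in N) & (w == u) ==> (v \in N)].

Lemma pendant_sym : symmetric pendant_edge.
Proof. by move=> v w; rewrite /pendant_edge eq_sym; congr (_ && _); rewrite andbC. Qed.

Lemma pendant_irr : irreflexive pendant_edge.
Proof. by move=> v; rewrite /pendant_edge eqxx. Qed.

Definition pendant_graph := SGraph pendant_sym pendant_irr.

Lemma pendant_edgeE v w : @edge pendant_graph v w = pendant_edge v w.
Proof. by []. Qed.

Lemma pendant_edge_off v w : v != u -> w != u -> pendant_edge v w = (v != w).
Proof. by move=> /negbTE vu /negbTE wu; rewrite /pendant_edge vu wu !andbT. Qed.

Lemma pendant_edge_tip w : pendant_edge u w = (w \in N).
Proof.
rewrite /pendant_edge eqxx /= (negbTE uN); case: (w =P u) => [->|/eqP wu].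
  by rewrite eqxx (negbTE uN).
by rewrite eq_sym wu /= andbT.
Qed.

Lemma pendant_iso a n : (0 < a)%N -> #|T| = n -> (a + 1 <= n)%N -> #|N| = (a - 1)%N ->
  sg_iso pendant_graph (graph_join (complete_graph (a - 1))
    (graph_union (complete_graph (n - a)) (complete_graph 1))).
Proof.
move=> a0 cT an cN; set H := graph_join _ _.
pose S := ~: (u |: N).
have cS : #|S| = (n - a)%N.
  by have := cardsC (u |: N); rewrite cardsU1 uN cN cT -/S; lia.
pose g (x : H) : T := match x with
  | inl i => enum_val (cast_ord (esym cN) i)
  | inr (inl i) => enum_val (cast_ord (esym cS) i)
  | inr (inr _) => u end.
have gN (i : 'I_(a - 1)) : enum_val (cast_ord (esym cN) i) \in N by apply: enum_valP.
have gS (i : 'I_(n - a)) : enum_val (cast_ord (esym cS) i) \in S by apply: enum_valP.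
have gNu i : (enum_val (cast_ord (esym cN) i) == u) = false.
  by apply/negP => /eqP e; have := gN i; rewrite e (negbTE uN).
have gSu i : (enum_val (cast_ord (esym cS) i) == u) = false.
  by have := gS i; rewrite !inE negb_or => /andP[/negbTE].
have gSN i : (enum_val (cast_ord (esym cS) i) \in N) = false.
  by have := gS i; rewrite !inE negb_or => /andP[_ /negbTE].
have gNS i j : (enum_val (cast_ord (esym cN) i) == enum_val (cast_ord (esym cS) j)) = false.
  by apply/negP => /eqP e; have := gN i; rewrite e gSN.
have injN i j : (enum_val (cast_ord (esym cN) i) == enum_val (cast_ord (esym cN) j)) = (i == j).
  by rewrite (inj_eq enum_val_inj) (inj_eq (@cast_ord_inj _ _ _)).
have injS i j : (enum_val (cast_ord (esym cS) i) == enum_val (cast_ord (esym cS) j)) = (i == j).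
  by rewrite (inj_eq enum_val_inj) (inj_eq (@cast_ord_inj _ _ _)).
have ginj : injective g.
  move=> [i|[i|i]] [j|[j|j]] /eqP; rewrite /= ?gNS ?gNu ?gSu ?injN ?injS //.
  - by move=> /eqP ->.
  - by rewrite eq_sym gNS.
  - by move=> /eqP ->.
  - by rewrite eq_sym gNu.
  - by rewrite eq_sym gSu.
  - by rewrite !ord1.
apply: sg_iso_sym; exists g.
  apply: inj_card_bij => //.
  by rewrite !card_sum !card_ord cT; lia.
move=> [i|[i|i]] [j|[j|j]]; rewrite /= /pendant_edge ?eqxx ?gNu ?gSu ?gNS ?injN ?injS
  ?[u == _]eq_sym ?gNu ?gSu ?gN ?gSN ?(negbTE uN) ?andbT ?andbF //=.
- by rewrite eq_sym gNS.
- by rewrite !ord1.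
Qed.

Variable R : realType.
Local Notation rho := (spectral_radius R pendant_graph).

(** Indicator of the clique formed by all vertices but [u]; its Rayleigh quotient is [#|T| - 2]. *)
Let ind (v : pendant_graph) : R := (v != u)%:R.

Let adj_ind v : v != u -> adj ind v = #|T|%:R - 2.
Proof.
move=> vu; rewrite adjE; apply/eqP; rewrite eq_sym subr_eq; apply/eqP.
rewrite -(sum1_card T) natr_sum.
have -> : 2 = \sum_(w : T) ((w == u)%:R + (w == v)%:R) :> R.
  by rewrite big_split /= -!natr_sum !sum_delta -natrD.
rewrite -big_split; apply: eq_bigr => w _; rewrite /= /ind.
case: (w =P u) => [->|/eqP wu]; first by rewrite eq_sym (negbTE vu) !mulr0 add0r addr0.
rewrite mulr1 /= ?pendant_edgeE pendant_edge_off // [w == v]eq_sym.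
by case: (v == w); rewrite /= ?add0r ?addr0.
Qed.

Let dot_ind : dot ind ind = #|T|%:R - 1.
Proof.
have e1 : \sum_(w : T) (w == u)%:R = 1 :> R by rewrite -natr_sum sum_delta.
have eT : \sum_(w : T) 1 = #|T|%:R :> R by rewrite sumr_const.
rewrite -eT -[X in _ - X]e1 -sumrB; apply: eq_bigr => w _; rewrite /ind.
by case: (w == u); rewrite /= ?mulr0 ?subrr ?mulr1 ?subr0.
Qed.

Let dot_adj_ind : dot ind (adj ind) = (#|T|%:R - 2) * dot ind ind.
Proof.
rewrite [in RHS]/dot mulr_sumr; apply: eq_bigr => v _.
have [vu|vu] := boolP (v == u); first by rewrite /ind vu !mul0r mulr0.
by rewrite adj_ind // mulrCA /ind vu !mulr1 mul1r.
Qed.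

Lemma pendant_spectral_radius_ge : (1 < #|T|)%N -> #|T|%:R - 2 <= rho.
Proof.
move=> T1; have d0 : 0 < dot ind ind by rewrite dot_ind subr_gt0 (ltr_nat R 1).
rewrite -(ler_pM2r d0) -dot_adj_ind; apply: rayleigh; exact: ltnW.
Qed.

(** Equality would make [ind] an eigenvector, but [ind] vanishes at [u] while its neighbour [w]
    makes [adj ind u] positive. *)
Lemma pendant_spectral_radius_gt w : (1 < #|T|)%N -> w \in N -> #|T|%:R - 2 < rho.
Proof.
move=> T1 wN; rewrite lt_def pendant_spectral_radius_ge // andbT.
apply/eqP => e; have T0 : (0 < #|pendant_graph|)%N by exact: ltnW.
have := @rayleigh_eq R pendant_graph T0 ind; rewrite dot_adj_ind e => /(_ erefl u).
rewrite {2}/ind eqxx mulr0 => /eqP; rewrite psumr_eq0; last by move=> ? _; apply: ler0n.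
move=> /allP/(_ w (mem_index_enum _)); rewrite ?pendant_edgeE pendant_edge_tip wN /= /ind.
by case: (w =P u) => [ew|_]; [move: uN; rewrite -ew wN|rewrite pnatr_eq0].
Qed.

Lemma pendant_edge_spectral_radius_gt0 v w : pendant_edge v w -> 0 < rho.
Proof.
move=> Pvw; have T0 : (0 < #|pendant_graph|)%N by apply/card_gt0P; exists v.
pose g (z : pendant_graph) : R := (z == v)%:R + (z == w)%:R.
have g0 z : 0 <= g z by rewrite addr_ge0.
have gv : 0 < g v by rewrite /g eqxx ltr_pwDl.
have gw : 0 < g w by rewrite /g eqxx ltr_pwDr.
have : 0 < dot g (adj g).
  rewrite /dot (bigD1 v) //= ltr_wpDr //.
    by apply: sumr_ge0 => z _; rewrite mulr_ge0 // sumr_ge0.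
  by rewrite mulr_gt0 // /adj (bigD1 w) //= ltr_wpDr // sumr_ge0.
move=> /lt_le_trans/(_ (rayleigh T0 g)); rewrite !ltNge; apply: contra => r0.
by rewrite mulr_le0_ge0 // dot_ge0.
Qed.

(** Only ends of edges are claimed, since [u] is isolated when [N] is empty. A zero at some [z != u]
    spreads to the whole clique and, as [rho > 0], to [u]. *)
Lemma pendant_eigenvector_gt0 (f : pendant_graph -> R) v w :
  (forall z, 0 <= f z) -> (exists z, f z != 0) ->
  (forall z, adj f z = rho * f z) -> pendant_edge v w -> 0 < f v /\ 0 < f w.
Proof.
move=> f0 [v0 fv0] fE Pvw; have rho0 := pendant_edge_spectral_radius_gt0 Pvw.
have fpos z : z != u -> 0 < f z.
  move=> zu; rewrite lt_def f0 andbT; apply/eqP => fz.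
  have /eqP : adj f z = 0 by rewrite fE fz mulr0.
  rewrite psumr_eq0 // => /allP h.
  have f_off z' : z' != u -> f z' = 0.
    move=> z'u; have [->//|nz] := eqVneq z' z.
    apply/eqP; have := h z' (mem_index_enum _).
    by rewrite ?pendant_edgeE pendant_edge_off // eq_sym nz.
  have fu : f u = 0.
    have : adj f u = 0.
      apply: big1 => z'; rewrite ?pendant_edgeE pendant_edge_tip => z'N.
      by apply: f_off; apply: contraNneq uN => <-.
    by rewrite fE => /eqP; rewrite mulf_eq0 (gt_eqF rho0) => /eqP.
  by move: fv0; have [->|/f_off ->] := eqVneq v0 u; rewrite ?fu eqxx.
have ftip z : z \in N -> 0 < f u.
  move=> zN; rewrite -(pmulr_rgt0 _ rho0) -fE /adj (bigD1 z) /=; last first.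
    by rewrite ?pendant_edgeE pendant_edge_tip.
  rewrite ltr_wpDr ?sumr_ge0 // fpos //; by apply: contraNneq uN => <-.
split.
  have [e|/fpos//] := eqVneq v u; move: Pvw; rewrite e pendant_edge_tip; exact: ftip.
have [e|/fpos//] := eqVneq w u; move: Pvw.
rewrite e pendant_sym pendant_edge_tip; exact: ftip.
Qed.

End Pendant.

(** * Spanning subgraphs of the extremal graph *)

Section Subgraph.
Variables (R : realType) (G : sgraph) (u : G) (N : {set G}).
Hypothesis uN : u \notin N.
Hypothesis sub : forall v w : G, edge v w -> pendant_edge u N v w.

Local Notation P := (pendant_graph u N).

Let G0 : (0 < #|G|)%N. Proof. by apply/card_gt0P; exists u. Qed.

Lemma dot_adj_mono (f : G -> R) : (forall v, 0 <= f v) ->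
  @dot R G f (@adj R G f) <= @dot R P f (@adj R P f).
Proof.
move=> f0; apply: ler_sum => v _; rewrite ler_wpM2l // !adjE; apply: ler_sum => w _.
by rewrite ler_wpM2r // ler_nat; case e: (edge v w) => //; rewrite ?pendant_edgeE sub.
Qed.

Lemma subgraph_spectral_radius : spectral_radius R G <= spectral_radius R P.
Proof.
have [f [f0 [v0 fv0] fE]] := nonneg_eigenvector R G0.
have d0 : 0 < dot f f := dot_gt0 fv0.
rewrite -(ler_pM2r d0); apply: le_trans (@rayleigh R P G0 f).
apply: le_trans (dot_adj_mono f0); rewrite le_eqVlt; apply/orP; left; apply/eqP.
by rewrite /dot mulr_sumr; apply: eq_bigr => v _; rewrite fE; ring.
Qed.

Lemma dot_adj_lt (f : G -> R) v w : (forall z, 0 <= f z) -> 0 < f v -> 0 < f w ->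
  pendant_edge u N v w -> ~~ edge v w ->
  @dot R G f (@adj R G f) < @dot R P f (@adj R P f).
Proof.
move=> f0 fv fw Pvw nGvw.
have adj_le z : @adj R G f z <= @adj R P f z.
  rewrite !adjE; apply: ler_sum => z' _; rewrite ler_wpM2r // ler_nat.
  by case e: (edge z z') => //; rewrite pendant_edgeE sub.
rewrite /dot (bigD1 v) //= [ltRHS](bigD1 v) //= ltr_leD //; last first.
  by apply: ler_sum => z _; rewrite ler_wpM2l.
rewrite ltr_pM2l // !adjE (bigD1 w) //= [ltRHS](bigD1 w) //= ltr_leD //.
  by rewrite (negbTE nGvw) mul0r ?pendant_edgeE Pvw mul1r.
apply: ler_sum => z _; rewrite ler_wpM2r // ler_nat.
by case e: (edge v z) => //; rewrite ?pendant_edgeE sub.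
Qed.

(** On equality the nonnegative eigenvector of [G] is also one of [P], hence positive at both ends
    of an edge of [P] missing from [G]. That edge would make the comparison strict. *)
Lemma subgraph_spectral_radius_eq : spectral_radius R G = spectral_radius R P ->
  forall v w : G, edge v w = pendant_edge u N v w.
Proof.
move=> rE v w; apply/idP/idP; first exact: sub.
move=> Pvw; apply/negPn/negP => nGvw.
have [f [f0 f_neq0 fE]] := nonneg_eigenvector R G0.
have GE : @dot R G f (@adj R G f) = spectral_radius R G * dot f f.
  by rewrite /dot mulr_sumr; apply: eq_bigr => z _; rewrite fE; ring.
have PE : @dot R P f (@adj R P f) = spectral_radius R P * @dot R P f f.
  apply/le_anti; rewrite (@rayleigh R P G0 f) /=.
  by apply: le_trans (dot_adj_mono f0); rewrite GE rE.
have [fv fw] := pendant_eigenvector_gt0 uN f0 f_neq0 (@rayleigh_eq R P G0 f PE) Pvw.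
by have := dot_adj_lt f0 fv fw Pvw nGvw; rewrite GE PE rE ltxx.
Qed.

End Subgraph.

(** * Sparsity of the complement and the two cases of the minimum degree *)

Lemma intermediate_set (T : finType) (X Y : {set T}) m :
  X \subset Y -> (#|X| <= m <= #|Y|)%N ->
  exists Z : {set T}, [/\ X \subset Z, Z \subset Y & #|Z| = m].
Proof.
move=> XY /andP[Xm mY]; pose s := take (m - #|X|) (enum (Y :\: X)).
have sYX z : z \in s -> z \in Y :\: X by move/mem_take; rewrite mem_enum.
exists (X :|: [set z in s]); split; first exact: subsetUl.
  apply/subsetP => z; rewrite in_setU => /orP[/(subsetP XY)//|].
  by rewrite inE => /sYX; rewrite inE => /andP[].
rewrite cardsU (_ : X :&: _ = set0); last first.
  apply/setP => z; rewrite !inE; apply/negP => /andP[zX /sYX].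
  by rewrite inE zX.
rewrite cards0 subn0 cardsE (card_uniqP _) ?take_uniq ?enum_uniq //.
rewrite size_take -cardE cardsD (setIidPr XY); case: ltnP; lia.
Qed.

Definition compl_edge (G : sgraph) : rel G := fun v w => (v != w) && ~~ edge v w.

Lemma compl_edge_sym (G : sgraph) : symmetric (@compl_edge G).
Proof. by move=> v w; rewrite /compl_edge eq_sym edge_sym. Qed.

Lemma compl_edge_irr (G : sgraph) : irreflexive (@compl_edge G).
Proof. by move=> v; rewrite /compl_edge eqxx. Qed.

Lemma degree_compl (G : sgraph) (v : G) :
  (degree (@compl_edge G) v + degree (@edge G) v + 1 = #|G|)%N.
Proof.
rewrite -[X in (_ + X)%N](sum_delta v) -sum_one !degreeE -!big_split.
apply: eq_bigr => w _ /=; rewrite /compl_edge [w == v]eq_sym.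
case: (v =P w) => [<-|_]; first by rewrite edge_irr.
by case: (edge v w).
Qed.

(** With [n = #|G|], the left side of [min_degree_bound] is at least its value [(n - 2) * k] at
    [n - 2], which leaves the complement a degree sum of at most [n + k - 1]. For [a > 1] strictness
    and integrality save one more. *)
Lemma min_degree_spectral_gap (R : realType) (G : sgraph) (a k : nat) :
  (0 < a)%N -> #|G| = (a + k + 1)%N -> (forall v : G, (a <= degree (@edge G) v)%N) ->
  #|G|%:R - 2 <= spectral_radius R G ->
  ((1 < a)%N -> #|G|%:R - 2 < spectral_radius R G) ->
  (\sum_v degree (@compl_edge G) v + 2 <= #|G| + k + (a == 1))%N.
Proof.
move=> a0 cG degG; set r := spectral_radius R G => r_ge r_gt.
have G0 : (0 < #|G|)%N by lia.
have := min_degree_bound R G0 degG; rewrite -/r; set m := (\sum_w _)%N => mb.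
have sumE : (\sum_v degree (@compl_edge G) v + m + #|G| = #|G| * #|G|)%N.
  rewrite -[X in (_ + X)%N]sum_one -!big_split /=.
  by rewrite (eq_bigr _ (fun v _ => degree_compl v)) sum_nat_const.
suff : (#|G| * #|G| + 3 + a <= m + 3 * #|G| + (a == 1))%N by lia.
set nR := #|G|%:R in mb r_ge r_gt; set aR := a%:R in mb.
have nE : nR = aR + k%:R + 1 by rewrite /nR cG !natrD.
have k0 : 0 <= k%:R :> R by [].
have [a1|a1] := eqVneq a 1%N.
  have aE : aR = 1 by rewrite /aR a1.
  rewrite a1 -(ler_nat R) !natrD !natrM -/nR /=.
  by rewrite aE in mb nE; nra.
have a2 : (1 < a)%N by lia.
have aR2 : 2 <= aR by rewrite /aR (ler_nat R 2).
have {}r_gt := r_gt a2.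
have lt : (nR - 2) * (nR - 2 - (aR - 1)) < r * (r - (aR - 1)).
  rewrite -subr_gt0.
  have -> : r * (r - (aR - 1)) - (nR - 2) * (nR - 2 - (aR - 1))
     = (r - (nR - 2)) * (r + (nR - 2) - (aR - 1)) by ring.
  by apply: mulr_gt0; lra.
have {}lt := lt_le_trans lt mb.
suff : (#|G| * #|G| + 2 + a < m + 3 * #|G|)%N by lia.
by rewrite -(ltr_nat R) !natrD !natrM -/nR -/aR; lra.
Qed.

Theorem theorem1p2 (R : realType) (a b n : nat) (G : sgraph)
    (a_gt0 : (0 < a)%N) (le_ab : (a <= b)%N)
    (order_G : #|G| = n) (n_ge : (n >= a + 1)%N)
    (parity : a = b -> (n * a = 0 %[mod 2])%N)
    (no_factor : ~ has_factor a b G) :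
  let H := graph_join (complete_graph (a - 1))
             (graph_union (complete_graph (n - a)) (complete_graph 1)) in
  spectral_radius R G <= spectral_radius R H /\
  (spectral_radius R G = spectral_radius R H <-> sg_iso G H).
Proof.
move=> H; have n1 : (1 < #|G|)%N by lia.
have [/existsP[u du]|] := boolP [exists u : G, (degree (@edge G) u < a)%N].
  (* The neighbourhood of [u] is enlarged to [a - 1] vertices; the pendant graph restricts only
     edges at [u], so it contains [G]. *)
  have [||N [sN Nu cN]] := @intermediate_set G [set w | edge u w] (~: [set u]) (a - 1).
  - by apply/subsetP => w; rewrite !inE => uw; apply: contraTneq uw => ->; rewrite edge_irr.
  - by rewrite -/(degree _ _) cardsC1; lia.
  have uN : u \notin N by apply/negP => /(subsetP Nu); rewrite !inE eqxx.
  have sub v w : edge v w -> pendant_edge u N v w.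
    move=> vw; rewrite /pendant_edge; apply/and3P; split.
    - by apply: contraTneq vw => ->; rewrite edge_irr.
    - by apply/implyP => /eqP e; apply: (subsetP sN); rewrite inE -e.
    - by apply/implyP => /eqP e; apply: (subsetP sN); rewrite inE -e edge_sym.
  have PH : sg_iso (pendant_graph u N) H by apply: pendant_iso.
  rewrite -(sg_iso_spectral_radius R PH); split; first exact: subgraph_spectral_radius.
  split=> [rE|GH]; last by rewrite (sg_iso_spectral_radius R GH) (sg_iso_spectral_radius R PH).
  have [f fb fE] := PH; exists f => // v w.
  by rewrite fE (subgraph_spectral_radius_eq uN sub rE).
rewrite negb_exists => /forallP deg_ge.
have {}deg_ge v : (a <= degree (@edge G) v)%N by rewrite leqNgt.
suff lt : spectral_radius R G < spectral_radius R H.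
  split; first exact: ltW.
  split=> [e|/(sg_iso_spectral_radius R)//]; by rewrite e ltxx in lt.
rewrite ltNge; apply/negP => HG; apply: no_factor.
(* Any [u] and [N] will do: they serve to place a copy of [H] on the vertices of [G] and bound its
   spectral radius from below. *)
have /card_gt0P[u _] : (0 < #|G|)%N by exact: ltnW.
have [||N [_ Nu cN]] := @intermediate_set G set0 (~: [set u]) (a - 1).
- exact: sub0set.
- by rewrite cards0 cardsC1; lia.
have uN : u \notin N by apply/negP => /(subsetP Nu); rewrite !inE eqxx.
have PH : sg_iso (pendant_graph u N) H by apply: pendant_iso.
rewrite -(sg_iso_spectral_radius R PH) in HG.
pose k := (n - 1 - a)%N; have cG : #|G| = (a + k + 1)%N by rewrite order_G /k; lia.
have sumD : (\sum_v degree (@compl_edge G) v + 2 <= #|G| + k + (a == 1))%N.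
  apply: (@min_degree_spectral_gap R) => //.
    by apply: le_trans HG; apply: pendant_spectral_radius_ge.
  move=> a1; have /card_gt0P[w wN] : (0 < #|N|)%N by rewrite cN; lia.
  by apply: lt_le_trans HG; apply: (pendant_spectral_radius_gt uN _ _ wN).
have [|v|F [Fs Fi FD Fd]] := factor_of_sparse_complement (@compl_edge_sym G)
  (@compl_edge_irr G) cG a_gt0 le_ab _ _ sumD.
- by move=> /parity; rewrite order_G mod0n modn2; case: (odd _).
- by have := degree_compl v; have := deg_ge v; lia.
exists F => //; split=> // v w Fvw.
have := FD _ _ Fvw; rewrite /compl_edge negb_and !negbK => /orP[/eqP e|//].
by rewrite e Fi in Fvw.
Qed.
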